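(* Let $\alpha\in(0,1)$ and let $b:\mathbb{R}\to\mathbb{R}$ be monotone increasing (not necessarily strictly) with $b(0)=0$ and $$|b(x)-b(y)|\le L_b|x-y|^\alpha\quad\text{for all }x,y\in\mathbb{R},$$ where $L_b>0$. Let $\delta>0$, $L=\frac1\delta$, $\tau>0$, $f\in L^2(\Omega)$, let $n\ge 1$ be fixed and let $u_h^{n-1}\in W_h$ be given. Let $i\in\mathbb{N}$, $i\ge1$, and let $u_h^{n,i-1}\in W_h$ be given. Let $(u_h^n,\mathbf q_h^n)\in W_h\times V_h$ be the solution of Problem $P_h^n$: for all $w_h\in W_h$, $\mathbf v_h\in V_h$, $$\langle b(u_h^n)-b(u_h^{n-1}),w_h\rangle+\tau\langle\nabla\cdot\mathbf q_h^n,w_h\rangle=\langle f,w_h\rangle,\qquad \langle\mathbf q_h^n,\mathbf v_h\rangle-\langle u_h^n,\nabla\cdot\mathbf v_h\rangle=0,$$ and let $(u_h^{n,i},\mathbf q_h^{n,i})\in W_h\times V_h$ be the solution of the linear Problem $P_h^{n,i}$: for all $w_h\in W_h$, $\mathbf v_h\in V_h$, $$\langle L(u_h^{n,i}-u_h^{n,i-1})+b(u_h^{n,i-1}),w_h\rangle+\tau\langle\nabla\cdot\mathbf q_h^{n,i},w_h\rangle=\langle b(u_h^{n-1}),w_h\rangle+\langle f,w_h\rangle,\qquad \langle\mathbf q_h^{n,i},\mathbf v_h\rangle-\langle u_h^{n,i},\nabla\cdot\mathbf v_h\rangle=0.$$ Set $e_u^{n,i}=u_h^{n,i}-u_h^n$,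 $e_u^{n,i-1}=u_h^{n,i-1}-u_h^n$ and $e_{\mathbf q}^{n,i}=\mathbf q_h^{n,i}-\mathbf q_h^n$. Then $$\|e_u^{n,i}\|^2+\tau\delta R(\delta,\tau)\|e_{\mathbf q}^{n,i}\|^2\le R(\delta,\tau)\|e_u^{n,i-1}\|^2+2C(\alpha)R(\delta,\tau)\,\delta^{\frac{2}{1-\alpha}},$$ where $$R(\delta,\tau)=\Big(1+\frac{\tau\delta}{C_\Omega^2}\Big)^{-1},\qquad C(\alpha)=\frac{1-\alpha}{2}\big(L_b(2\alpha)^\alpha\big)^{\frac{2}{1-\alpha}}(1+\alpha)^{-\frac{1+\alpha}{1-\alpha}}\sigma(\Omega).$$
   Context: $\Omega\subset\mathbb{R}^d$, $d\in\{1,2,3\}$, is a bounded domain with Lipschitz continuous boundary; $\sigma(\Omega)$ is its volume. $\langle\cdot,\cdot\rangle$ is the inner product of $L^2(\Omega)$ (also used for $(L^2(\Omega))^d$) and $\|\cdot\|$ the corresponding norm. $H(\mathrm{div};\Omega)=\{\mathbf f\in(L^2(\Omega))^d : \nabla\cdot\mathbf f\in L^2(\Omega)\}$. $\mathcal T_h$ is a regular decomposition of $\Omega$ with mesh size $h$, and $W_h\times V_h\subset L^2(\Omega)\times H(\mathrm{div};\Omega)$ are the lowest-order Raviart-Thomas spaces $$W_h=\{p\in L^2(\Omega): p|_T \text{ is constant for all }T\in\mathcal T_h\},$$ $$V_h=\{\mathbf q\in H(\mathrm{div};\Omega): \mathbf q|_T(\mathbf x)=\mathbf a_T+b_T\mathbf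 x,\ \mathbf a_T\in\mathbb{R}^d,\ b_T\in\mathbb{R},\ \text{for all }T\in\mathcal T_h\}.$$ $C_\Omega>0$ denotes a constant, not depending on $h$, with the following (known) property, which may be assumed: for every $w_h\in W_h$ there exists $\mathbf v_h\in V_h$ with $\nabla\cdot\mathbf v_h=w_h$ and $\|\mathbf v_h\|\le C_\Omega\|w_h\|$. $\tau$ is the (constant) time step size. It is a standing assumption that Problem $P_h^n$ has a unique solution. The problems are backward Euler / mixed finite element discretisations (and their linearisation) of $\partial_t b(u)-\nabla\cdot(\nabla u)=f$ with homogeneous Dirichlet boundary conditions. *)

(* Defs.v *)
From HB Require Import structures.
From mathcomp Require Import all_boot all_order all_algebra.
From mathcomp Require Import all_classical all_reals all_analysis.
From mathcomp Require Import measurable_realfun.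

Set Implicit Arguments.
Unset Strict Implicit.
Unset Printing Implicit Defensive.
Import Order.TTheory GRing.Theory Num.Theory.
Import numFieldNormedType.Exports.

Local Open Scope classical_set_scope.
Local Open Scope ring_scope.

(* R^d is ['rV[R]_d] with its Borel sigma-algebra.
   Elements of L^2 are represented by functions on R^d of which only the
   values on the domain matter; equality in L^2 is equality a.e. there. *)

Section BorelRn.
Context {R : realType} {d : nat}.

Let borel : set (set 'rV[R]_d) := <<s [set U | open U] >>.

Let borel0 : borel set0. Proof. exact: sigma_algebra0. Qed.
Let borelC A : borel A -> borel (~` A). Proof. exact: sigma_algebraC. Qed.
Let borel_bigcup (F : (set 'rV[R]_d)^nat) :
  (forall i, borel (F i)) -> borel (\bigcup_i F i).
Proof. exact: sigma_algebra_bigcup. Qed.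

HB.instance Definition _ :=
  @isMeasurable.Build default_measure_display 'rV[R]_d borel
    borel0 borelC borel_bigcup.

Lemma open_measurable_rV (U : set 'rV[R]_d) : open U -> measurable U.
Proof. exact: sub_gen_smallest. Qed.

End BorelRn.

Section LebesgueRn.
Context {R : realType}.

(* The identification R * R^d = R^(d+1); Lebesgue measure on R^d is built below
   as an iterated product, and [lebesgue_rV_box] checks the normalisation. *)
Definition cons_rV {d} (p : measurableTypeR R * 'rV[R]_d) : 'rV[R]_d.+1 :=
  \row_j if unlift ord0 j is Some k then p.2 0 k else p.1.

Lemma cons_rV_ball d (p q : R * 'rV[R]_d) (e : R) :
  ball p.1 e q.1 -> ball p.2 e q.2 -> ball (cons_rV p) e (cons_rV q).
Proof.
move=> b1 [e0 b2]; split => // i j; rewrite !mxE.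
by case: unliftP => [k _|_]; [exact: b2|exact: b1].
Qed.

Lemma measurable_cons_rV d : measurable_fun setT (@cons_rV d).
Proof.
apply: (measurability ([set U | open U] : set (set 'rV[R]_d.+1))) => //.
move=> _ [U oU <-]; rewrite setTI.
pose r (k : nat) : R := k.+1%:R^-1.
pose B (t : rat * 'rV[rat]_d * nat) : set (measurableTypeR R * 'rV[R]_d) :=
  ball (ratr t.1.1 : R) (r t.2) `*` ball (map_mx ratr t.1.2 : 'rV[R]_d) (r t.2).
pose D := [set t | B t `<=` cons_rV @^-1` U].
have -> : cons_rV @^-1` U = \bigcup_(t in D) B t.
  apply/seteqP; split => [p Up|p [t Dt]]; last exact: Dt.
  have : nbhs (cons_rV p) U by exact: open_nbhs_nbhs.
  move=> /nbhs_ballP[e /= e0 eU].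
  have [k ke] : exists k, r k < e / 2.
    exists (Num.truncn (e / 2)^-1); rewrite /r -[ltRHS]invrK ltf_pV2 ?posrE ?invr_gt0 ?divr_gt0//.
    by rewrite truncnS_gt.
  have r0 : 0 < r k by rewrite invr_gt0.
  have rat_near (x : R) : exists q : rat, ball (ratr q : R) (r k) x.
    have /rat_in_itvoo[q] : x - r k < x + r k by rewrite ltrBlDr -addrA ltrDl addr_gt0.
    rewrite in_itv/= => /andP[q1 q2]; exists q.
    by rewrite ball_symE /ball/= ltr_distlC q1 q2.
  have [q hq] := rat_near p.1.
  have [v hv] : exists v : 'rV[rat]_d, forall i, ball (ratr (v 0 i) : R) (r k) (p.2 0 i).
    exists (\row_i projT1 (cid (rat_near (p.2 0 i)))) => i.
    by rewrite mxE; case: cid.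
  exists (q, v, k); last first.
    split => //=; split => // i j; rewrite ord1 mxE; exact: hv.
  move=> y [/= y1 y2]; apply: eU; apply: cons_rV_ball.
    have := ball_triangle (ball_sym hq) y1; apply: le_ball.
    by rewrite ltW// [e]splitr ltrD.
  have h : ball p.2 (r k) (map_mx ratr v : 'rV[R]_d).
    by split => // i j; rewrite ord1 mxE; apply: ball_sym; exact: hv.
  have := ball_triangle h y2; apply: le_ball.
  by rewrite ltW// [e]splitr ltrD.
rewrite bigcup_mkcond.
apply: countable_bigcupT_measurable => [|t]; first exact: countableP.
have rt0 : 0 < r t.2 by rewrite invr_gt0.
case: ifPn => // _; apply: measurableX.
  by apply: open_measurable; exact: ball_open.
by apply: open_measurable_rV; exact: ball_open.
Qed.

Section lebesgue_rV_step.
Context {d : nat} (m : {sigma_finite_measure set 'rV[R]_d -> \bar R}).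

Definition lebesgue_rV_step : set 'rV[R]_d.+1 -> \bar R :=
  pushforward (lebesgue_measure \x m)%E (@cons_rV d).

Let step0 : lebesgue_rV_step set0 = 0%E.
Proof. by rewrite /lebesgue_rV_step /pushforward preimage_set0 measure0. Qed.

Let step_ge0 A : (0 <= lebesgue_rV_step A)%E.
Proof. by rewrite /lebesgue_rV_step /pushforward; exact: measure_ge0. Qed.

Let step_sigma_additive : semi_sigma_additive lebesgue_rV_step.
Proof.
move=> F mF tF mUF; rewrite /lebesgue_rV_step /pushforward preimage_bigcup.
have mcons A : measurable A -> measurable (@cons_rV d @^-1` A).
  by move=> mA; rewrite -[X in measurable X]setTI; exact: measurable_cons_rV.
apply: measure_semi_sigma_additive => [n||].
- exact: mcons.
- apply/trivIsetP => /= i j _ _ ij; rewrite -preimage_setI.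
  by move/trivIsetP : tF => /(_ _ _ _ _ ij) ->//; rewrite preimage_set0.
- by rewrite -preimage_bigcup; exact: mcons.
Qed.

HB.instance Definition _ := isMeasure.Build _ _ _ lebesgue_rV_step
  step0 step_ge0 step_sigma_additive.

Let step_sigma_finite : sigma_finite setT lebesgue_rV_step.
Proof.
pose tl (x : 'rV[R]_d.+1) : 'rV[R]_d := \row_k x 0 (lift ord0 k).
have mhd : measurable_fun setT (fun x : 'rV[R]_d.+1 => x 0 0).
  apply: (measurability _ (RGenOpens.measurableE R)) => _ [_ [a [b ->] <-]].
  rewrite setTI; apply: open_measurable_rV.
  have /continuousP := @coord_continuous R 1 d.+1 0 0; apply.
  exact: interval_open.
have mtl : measurable_fun setT tl.
  apply: (measurability ([set U | open U] : set (set 'rV[R]_d))) => //.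
  move=> _ [U oU <-]; rewrite setTI; apply: open_measurable_rV.
  rewrite openE => x Ux; have : nbhs (tl x) U by exact: open_nbhs_nbhs.
  move=> /nbhs_ballP[e /= e0 eU]; apply/nbhs_ballP; exists e => // y [_ xy].
  by apply: eU; split => // i j; rewrite !mxE.
have /sigma_finiteP[F [TF ndF Foo]] :=
  sigma_finiteT (lebesgue_measure : {sigma_finite_measure set _ -> \bar R}).
have /sigma_finiteP[G [TG ndG Goo]] := sigma_finiteT m.
pose h (x : 'rV[R]_d.+1) : measurableTypeR R * 'rV[R]_d := (x 0 0, tl x).
have mh : measurable_fun setT h by exact: measurable_fun_pair.
have hK : h \o @cons_rV d = id.
  apply/funext => -[x y]; rewrite /h /cons_rV /= !mxE unlift_none; congr pair.
  by apply/rowP => k; rewrite !mxE liftK.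
exists (fun n => h @^-1` (F n `*` G n)).
  rewrite -preimage_bigcup; apply/seteqP; split => // x _.
  have [n _ Fn] : (\bigcup_i F i) (h x).1 by rewrite -TF.
  have [k _ Gk] : (\bigcup_i G i) (h x).2 by rewrite -TG.
  exists (maxn n k) => //; split.
    by apply: (subsetPset _ _ (ndF _ _ (leq_maxl n k))).
  by apply: (subsetPset _ _ (ndG _ _ (leq_maxr n k))).
move=> n; have [mF Fn] := Foo n; have [mG Gn] := Goo n; split.
  by rewrite -[X in measurable X]setTI; apply: mh => //; exact: measurableX.
rewrite /lebesgue_rV_step /pushforward -comp_preimage hK preimage_id.
by rewrite product_measure1E// lte_mul_pinfty// ge0_fin_numE.
Qed.

HB.instance Definition _ := Measure_isSigmaFinite.Build _ _ _ lebesgue_rV_step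
  step_sigma_finite.
End lebesgue_rV_step.

Fixpoint lebesgue_rV d : {sigma_finite_measure set 'rV[R]_d -> \bar R} :=
  if d is d'.+1 then lebesgue_rV_step (lebesgue_rV d') else \d_(0 : 'rV[R]_0).

Lemma lebesgue_rV_box d (a b : 'rV[R]_d) : (forall i, a 0 i <= b 0 i) ->
  lebesgue_rV d [set x | forall i, a 0 i <= x 0 i <= b 0 i] =
  (\prod_i (b 0 i - a 0 i))%:E.
Proof.
elim: d a b => [|d IH] a b ab /=.
  by rewrite big_ord0 diracE mem_set => //= -[].
pose tl (x : 'rV[R]_d.+1) : 'rV[R]_d := \row_k x 0 (lift ord0 k).
rewrite /lebesgue_rV_step /pushforward.
have -> : cons_rV @^-1` [set x : 'rV[R]_d.+1 | forall i, a 0 i <= x 0 i <= b 0 i] =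
    `[a 0 0, b 0 0]%classic `*`
    [set x : 'rV[R]_d | forall i, (tl a) 0 i <= x 0 i <= (tl b) 0 i].
  apply/seteqP; split => [[x y] /= h|[x y] /= [h1 h2] i].
    split; first by have := h 0; rewrite in_itv/= !mxE unlift_none.
    by move=> i; have := h (lift ord0 i); rewrite !mxE liftK.
  rewrite !mxE; case: unliftP => [k ->|->]; last by move: h1; rewrite in_itv.
  by have := h2 k; rewrite !mxE.
have tlab i : tl a 0 i <= tl b 0 i by rewrite !mxE.
rewrite product_measure1E//; last first.
  rewrite (_ : [set x | _] = \bigcap_(i in [set: 'I_d])
    [set x : 'rV[R]_d | x 0 i \in `[tl a 0 i, tl b 0 i]]); last first.
    apply/seteqP; split => [x h i _|x h i]; first by rewrite /= in_itv; exact: h.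
    by have := h i Logic.I; rewrite /= in_itv.
  apply: fin_bigcap_measurable => // i _; rewrite -[X in measurable X]setCK.
  apply: measurableC; apply: open_measurable_rV; rewrite openC.
  apply: (@preimage_closed _ _ (fun x : 'rV[R]_d => x 0 i)
    [set t : R | t \in `[tl a 0 i, tl b 0 i]]).
    by move=> x _; exact: coord_continuous.
  exact: interval_closed.
have := lebesgue_measure_itv `[a 0 0, b 0 0]; rewrite /= lte_fin => leb_ab.
transitivity ((b 0 0 - a 0 0)%:E * (\prod_i (tl b 0 i - tl a 0 i))%:E)%E.
  congr (_ * _)%E; last exact: IH.
  apply: etrans leb_ab _.
  by have := ab 0; rewrite le_eqVlt => /predU1P[->|->]; rewrite ?ltxx ?subrr.
rewrite -EFinM big_ord_recl; congr (_ * _)%:E.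
by apply: eq_bigr => i _; rewrite !mxE.
Qed.

End LebesgueRn.

Section L2.
Context {R : realType} {d : nat}.
Implicit Types (Om : set 'rV[R]_d) (f g : 'rV[R]_d -> R).
Implicit Types (p q : 'rV[R]_d -> 'rV[R]_d).

Definition dotv (u v : 'rV[R]_d) : R := \sum_(i < d) u 0 i * v 0 i.
Definition enorm (u : 'rV[R]_d) : R := Num.sqrt (dotv u u).

Definition L2 Om f : Prop := f \_ Om \in Lfun (lebesgue_rV d) 2%:E.
Definition L2v Om q : Prop := forall i, L2 Om (fun x => q x 0 i).

Definition ip Om f g : R := \int[lebesgue_rV d]_(x in Om) (f x * g x).
Definition ipv Om p q : R := \int[lebesgue_rV d]_(x in Om) dotv (p x) (q x).
Definition norm2 Om f : R := Num.sqrt (ip Om f f).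
Definition norm2v Om q : R := Num.sqrt (ipv Om q q).

Definition volume Om : R := fine (lebesgue_rV d Om).

End L2.

Section Domain.
Context {R : realType} {d : nat}.
Implicit Types (Om : set 'rV[R]_d).

(* Near each boundary point, Om is the set lying strictly above the graph of a
   Lipschitz function g in some rotated coordinate system: e is the unit vector
   of the last axis and the hyperplane orthogonal to e carries the others.
   The library's sup-norm and its balls may be used as all norms are
   equivalent on R^d. *)
Definition lipschitz_boundary Om : Prop :=
  forall x0, (closure Om `\` interior Om) x0 ->
  exists (r : R) (e : 'rV[R]_d) (M : R) (g : 'rV[R]_d -> R),
    [/\ 0 < r, dotv e e = 1,
        (forall y z, dotv y e = 0 -> dotv z e = 0 ->
           `|g y - g z| <= M * `|y - z|)
      & Om `&` ball x0 r =
        [set x | g (x - dotv x e *: e) < dotv x e] `&` ball x0 r].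

Definition bounded_lipschitz_domain Om : Prop :=
  [/\ Om !=set0, open Om, connected Om, bounded_set Om & lipschitz_boundary Om].

End Domain.

Section WeakDivergence.
Context {R : realType} {d : nat}.
Implicit Types (Om : set 'rV[R]_d) (phi g : 'rV[R]_d -> R).
Implicit Types (q : 'rV[R]_d -> 'rV[R]_d).

Definition partial (i : 'I_d) phi : 'rV[R]_d -> R :=
  fun x => 'D_(delta_mx 0 i) phi x.

Definition iter_partial (s : seq 'I_d) phi : 'rV[R]_d -> R := foldr partial phi s.

Definition smooth phi : Prop := forall s : seq 'I_d,
  continuous (iter_partial s phi) /\
  forall i x, derivable (iter_partial s phi) x (delta_mx 0 i).

Definition test_function Om phi : Prop :=
  smooth phi /\
  exists K, [/\ compact K, K `<=` Om & forall x, ~ K x -> phi x = 0].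

Definition grad phi (x : 'rV[R]_d) : 'rV[R]_d := \row_i partial i phi x.

(* [weak_div Om q g] : g is a representative of the divergence of q, in the
   sense of distributions on Om; such a g is unique up to a.e. equality. *)
Definition weak_div Om q g : Prop :=
  [/\ L2v Om q, L2 Om g &
      forall phi, test_function Om phi -> ipv Om q (grad phi) = - ip Om g phi].

Definition Hdiv Om q : Prop := exists g, weak_div Om q g.

End WeakDivergence.

Section Mesh.
Context {R : realType} {d : nat}.
Implicit Types (Om T F : set 'rV[R]_d) (Th : set (set 'rV[R]_d)).

(* The rows of [v] are the d+1 vertices. *)
Definition affinely_independent (v : 'M[R]_(d.+1, d)) : Prop :=
  forall l : 'rV[R]_d.+1, l *m v = 0 -> \sum_i l 0 i = 0 -> l = 0.

Definition conv_vertices (v : 'M[R]_(d.+1, d)) (I : pred 'I_d.+1) :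
    set 'rV[R]_d :=
  [set x | exists l : 'rV[R]_d.+1,
    [/\ forall i, 0 <= l 0 i, forall i, ~~ I i -> l 0 i = 0,
        \sum_i l 0 i = 1 & x = l *m v]].

Definition simplex T : Prop :=
  exists2 v, affinely_independent v & T = conv_vertices v predT.

(* The empty set is a face. *)
Definition face_of F T : Prop :=
  exists v I, [/\ affinely_independent v, T = conv_vertices v predT
                & F = conv_vertices v I].

Definition diameter T : R :=
  sup [set r | exists x y, [/\ T x, T y & r = enorm (x - y)]].

Definition mesh_size Th : R := sup [set diameter T | T in Th].

Definition regular_decomposition Om Th (h : R) : Prop :=
  [/\ finite_set Th,
      forall T, Th T -> simplex T,
      closure Om = \bigcup_(T in Th) T,
      forall T T', Th T -> Th T' -> face_of (T `&` T') T /\ face_of (T `&` T') T'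
    & h = mesh_size Th].

End Mesh.

Section RaviartThomas.
Context {R : realType} {d : nat}.
Variables (Om : set 'rV[R]_d) (Th : set (set 'rV[R]_d)).
Implicit Types (w u f : 'rV[R]_d -> R) (q v : 'rV[R]_d -> 'rV[R]_d).

Definition Wh w : Prop :=
  L2 Om w /\
  forall T, Th T -> exists c : R, ae_eq (lebesgue_rV d) T w (cst c).

Definition Vh q : Prop :=
  Hdiv Om q /\
  forall T, Th T -> exists (a : 'rV[R]_d) (b : R),
    ae_eq (lebesgue_rV d) T q (fun x => a + b *: x).

Definition div_stable (C : R) : Prop :=
  forall w, Wh w ->
  exists v, [/\ Vh v, weak_div Om v w & norm2v Om v <= C * norm2 Om w].

(* In both problems [dq] and [dv] range over all representatives of the
   divergences of [q] and [v]. *)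
Definition solves_P (b : R -> R) (tau : R) f uprev u q : Prop :=
  [/\ Wh u, Vh q,
      (forall w dq, Wh w -> weak_div Om q dq ->
        ip Om ((b \o u) \- (b \o uprev)) w + tau * ip Om dq w = ip Om f w)
    & (forall v dv, Vh v -> weak_div Om v dv ->
        ipv Om q v - ip Om u dv = 0)].

Definition uniquely_solvable_P (b : R -> R) (tau : R) f uprev : Prop :=
  exists u q, solves_P b tau f uprev u q /\
    forall u' q', solves_P b tau f uprev u' q' ->
      ae_eq (lebesgue_rV d) Om u' u /\ ae_eq (lebesgue_rV d) Om q' q.

Definition solves_P_lin (b : R -> R) (L tau : R) f uprev uold u q : Prop :=
  [/\ Wh u, Vh q,
      (forall w dq, Wh w -> weak_div Om q dq ->
        ip Om (fun x => L * (u x - uold x) + b (uold x)) w + tau * ip Om dq w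
        = ip Om (b \o uprev) w + ip Om f w)
    & (forall v dv, Vh v -> weak_div Om v dv ->
        ipv Om q v - ip Om u dv = 0)].

End RaviartThomas.

Section Constants.
Context {R : realType}.

Definition Rfactor (COm delta tau : R) : R := (1 + tau * delta / COm ^+ 2)^-1.

Definition Cholder (Lb sigma alpha : R) : R :=
  (1 - alpha) / 2 * (Lb * (2 * alpha) `^ alpha) `^ (2 / (1 - alpha))
  * (1 + alpha) `^ (- ((1 + alpha) / (1 - alpha))) * sigma.

End Constants.

(* Main.v *)
Require Import Defs.
From mathcomp Require Import all_boot all_order all_algebra.
From mathcomp Require Import all_classical all_reals all_analysis.
From mathcomp Require Import measurable_realfun.
From mathcomp Require Import ring lra.

Set Implicit Arguments.
Unset Strict Implicit.
Unset Printing Implicit Defensive.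
Import Order.TTheory GRing.Theory Num.Theory.
Import numFieldNormedType.Exports.

Local Open Scope classical_set_scope.
Local Open Scope ring_scope.

(** The error is estimated by an energy argument in which the Hoelder
    continuity of b enters through one scalar inequality.

    Write u0, u1 for the old and the new iterate, u for the exact discrete
    solution, q1, q for the fluxes, e = u1 - u, eq = q1 - q, and
    g = (u0 - u) - delta (b(u0) - b(u)).  Subtracting the two scalar equations,
    testing with e and multiplying by delta = 1/L gives
      <e, e> + tau delta <div eq, e> = <g, e>,
    and the two flux equations turn <div eq, e> into the squared norm of eq
    ([discrete_flux_energy]).  With 2 <g, e> <= |g|^2 + |e|^2 this yields
      |e|^2 + 2 tau delta |eq|^2 <= |g|^2.

    On the right, monotonicity of b makes the cross term of |g|^2 favourable:
    with D = |u0 - u| and B = |b(u0) - b(u)|, pointwise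
      g^2 = D^2 - 2 delta D B + delta^2 B^2.
    As B <= Lb D^alpha, the square B^2 is at most a constant times (D B)^s with
    s = 2 alpha / (1 + alpha) < 1, so Young's inequality absorbs delta^2 B^2
    into delta D B, up to an additive constant, which is the one in
    [Cholder] ([holder_dissipation]).  Integrating over the bounded domain
    produces its volume ([linearisation_error]).

    On the left, one copy of tau delta |eq|^2 is kept and the other one is
    traded for (tau delta / COm^2) |e|^2: div-stability provides v with
    div v = e, whence |e|^2 = <eq, v> <= COm |eq| |e| ([discrete_poincare]).
    Multiplication by [Rfactor] gives the claim.

    The derivation of the error equation splits the integrals, so b(u) has to
    be square integrable.  This holds because b grows at most linearly and the
    domain has finite measure ([L2_comp_holder],
    [bounded_lebesgue_rV_fin]). *)

(** * Inner products of square integrable functions *)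

Section L2Theory.
Context {R : realType} {d : nat}.
Variables (Om : set 'rV[R]_d) (mOm : measurable Om).
Implicit Types (f g k : 'rV[R]_d -> R) (p q r : 'rV[R]_d -> 'rV[R]_d).
Local Notation mu := (lebesgue_rV d).

Lemma L2P f : L2 Om f <->
  measurable_fun Om f /\ mu.-integrable Om (EFin \o (fun x => f x ^+ 2)).
Proof.
have sqE : (EFin \o (fun x => f x ^+ 2)) \_ Om = EFin \o (fun x => (f \_ Om) x ^+ 2).
  by apply/funext => x; rewrite /= !patchE; case: ifPn => //; rewrite expr0n.
have iE : mu.-integrable Om (EFin \o (fun x => f x ^+ 2)) <->
          mu.-integrable setT (EFin \o (fun x => (f \_ Om) x ^+ 2)).
  have := integrable_restrict mu mOm measurableT (EFin \o (fun x => f x ^+ 2)).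
  by rewrite setTI sqE.
split=> [l2f|[mf /iE iff]].
  split; last by apply/iE; exact: Lfun2_integrable_sqr.
  by apply/(measurable_restrictT _ mOm); move: l2f => /sub_Lfun_mfun; rewrite inE.
apply/andP; split; first by rewrite inE/=; exact/(measurable_restrictT _ mOm).
rewrite inE/= /finite_norm unlock poweR_lty//.
move/integrableP : iff => [_]; apply: le_lt_trans.
rewrite le_eqVlt; apply/orP; left; apply/eqP; apply: eq_integral => x _ /=.
by rewrite powR_mulrn// normrX.
Qed.

Lemma L2B f g : L2 Om f -> L2 Om g -> L2 Om (f \- g).
Proof.
move=> lf lg; rewrite /L2 (_ : _ \_ _ = f \_ Om - g \_ Om).
  by apply: rpredB => //; rewrite lee1n.
by apply/funext => x; rewrite /= !fctE !patchE; case: ifPn => //; rewrite subr0.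
Qed.

Lemma L2Z a f : L2 Om f -> L2 Om (fun x => a * f x).
Proof.
move=> lf; rewrite /L2 (_ : _ \_ _ = a *: (f \_ Om)).
  by apply: rpredZ => //; rewrite lee1n.
by apply/funext => x; rewrite /= !fctE !patchE; case: ifPn => //; rewrite scaler0.
Qed.

Lemma L2_integrableM f g : L2 Om f -> L2 Om g ->
  mu.-integrable Om (EFin \o (fun x => f x * g x)).
Proof.
move=> lf lg; have /Lfun1_integrable := Lfun2_mul_Lfun1 lf lg.
have := integrable_restrict mu mOm measurableT (EFin \o (fun x => f x * g x)).
rewrite setTI => -[_ h] fg; apply: h; apply: eq_integrable fg => // x _.
by rewrite /= !patchE; case: ifPn => //; rewrite mulr0.
Qed.

Lemma ipC f g : ip Om f g = ip Om g f.
Proof. by apply: eq_Rintegral => x _; rewrite mulrC. Qed.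

Lemma ipBl f g k : L2 Om f -> L2 Om g -> L2 Om k ->
  ip Om (f \- g) k = ip Om f k - ip Om g k.
Proof.
move=> lf lg lk; rewrite -RintegralB//; try exact: L2_integrableM.
by apply: eq_Rintegral => x _; rewrite mulrBl.
Qed.

Lemma ipDl f g k : L2 Om f -> L2 Om g -> L2 Om k ->
  ip Om (f \+ g) k = ip Om f k + ip Om g k.
Proof.
move=> lf lg lk; rewrite -RintegralD//; try exact: L2_integrableM.
by apply: eq_Rintegral => x _; rewrite mulrDl.
Qed.

Lemma ipZl a f g : L2 Om f -> L2 Om g ->
  ip Om (fun x => a * f x) g = a * ip Om f g.
Proof.
move=> lf lg; rewrite -RintegralZl//; try exact: L2_integrableM.
by apply: eq_Rintegral => x _; rewrite mulrA.
Qed.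

Lemma ipBr f g k : L2 Om f -> L2 Om g -> L2 Om k ->
  ip Om k (f \- g) = ip Om k f - ip Om k g.
Proof. by move=> *; rewrite !(ipC k) ipBl. Qed.

Lemma ipZr a f g : L2 Om f -> L2 Om g ->
  ip Om g (fun x => a * f x) = a * ip Om g f.
Proof. by move=> *; rewrite !(ipC g) ipZl. Qed.

Lemma ip_ge0 f : 0 <= ip Om f f.
Proof. by apply: Rintegral_ge0 => x _; rewrite -expr2 sqr_ge0. Qed.

Lemma norm2_sqr f : norm2 Om f ^+ 2 = ip Om f f.
Proof. by rewrite sqr_sqrtr// ip_ge0. Qed.

(** Young's inequality replaces Cauchy-Schwarz throughout: it passes
    coordinatewise to vector fields, and the weight t absorbs the stability
    constant. *)
Lemma ip_young t f g : 0 < t -> L2 Om f -> L2 Om g ->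
  2 * ip Om f g <= t * ip Om f f + t^-1 * ip Om g g.
Proof.
move=> t0 lf lg; have := ip_ge0 ((fun x => t * f x) \- g).
have ltf := L2Z t lf.
rewrite ipBl ?ipBr ?ipZl ?ipZr//; last exact: L2B.
rewrite (ipC g f) => h.
rewrite -(ler_pM2l t0) mulrDr mulVKf ?gt_eqF//.
by move: h; nra.
Qed.

Lemma ipvE p q : L2v Om p -> L2v Om q ->
  ipv Om p q = \sum_i ip Om (fun x => p x 0 i) (fun x => q x 0 i).
Proof.
move=> lp lq; rewrite /ipv /dotv.
have ipq i : mu.-integrable Om (EFin \o (fun x => p x 0 i * q x 0 i)).
  by apply: L2_integrableM; [exact: lp|exact: lq].
elim: (index_enum 'I_d) => [|i s IH].
  rewrite big_nil -[RHS](mul0r (fine (mu Om))) -Rintegral_cst//.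
  by apply: eq_Rintegral => x _; rewrite big_nil.
rewrite big_cons -IH -RintegralD//.
  by apply: eq_Rintegral => x _; rewrite big_cons.
rewrite (_ : _ \o _ = fun x => (\sum_(j <- s) (p x 0 j * q x 0 j)%:E)%E).
  by apply: integrable_sum => // j _; exact: ipq.
by apply/funext => x /=; rewrite sumEFin.
Qed.

Lemma ipvC p q : ipv Om p q = ipv Om q p.
Proof.
by apply: eq_Rintegral => x _; apply: eq_bigr => i _; rewrite mulrC.
Qed.

Lemma L2vB p q : L2v Om p -> L2v Om q -> L2v Om (p \- q).
Proof.
move=> lp lq i; rewrite (_ : (fun x => _) = (fun x => p x 0 i) \- (fun x => q x 0 i)).
  exact: L2B.
by apply/funext => x; rewrite !mxE.
Qed.

Lemma ipvBl p q r : L2v Om p -> L2v Om q -> L2v Om r ->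
  ipv Om (p \- q) r = ipv Om p r - ipv Om q r.
Proof.
move=> lp lq lr; rewrite !ipvE//; last exact: L2vB.
rewrite -sumrB; apply: eq_bigr => i _; rewrite -ipBl//.
by apply: eq_Rintegral => x _; rewrite !mxE.
Qed.

Lemma ipvBr p q r : L2v Om p -> L2v Om q -> L2v Om r ->
  ipv Om r (p \- q) = ipv Om r p - ipv Om r q.
Proof. by move=> *; rewrite !(ipvC r) ipvBl. Qed.

Lemma norm2v_sqr p : norm2v Om p ^+ 2 = ipv Om p p.
Proof.
rewrite sqr_sqrtr//; apply: Rintegral_ge0 => x _.
by apply: sumr_ge0 => i _; rewrite -expr2 sqr_ge0.
Qed.

Lemma ipv_young t p q : 0 < t -> L2v Om p -> L2v Om q ->
  2 * ipv Om p q <= t * ipv Om p p + t^-1 * ipv Om q q.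
Proof.
move=> t0 lp lq; rewrite !ipvE// !mulr_sumr -big_split/=.
by apply: ler_sum => i _; apply: ip_young.
Qed.

End L2Theory.

(** * Square integrability of b(u) *)

Lemma bounded_lebesgue_rV_fin {R : realType} {d : nat} (A : set 'rV[R]_d) :
  measurable A -> bounded_set A -> (lebesgue_rV d A < +oo)%E.
Proof.
move=> mA [M [_ bA]].
(* [bA] bounds A by the radii strictly above M only, hence the + 1. *)
pose m := `|M| + 1.
have M_le := ler_norm M; have M_ge0 := normr_ge0 M.
have bm x : A x -> `|x| <= m by apply: bA; rewrite ltr_pwDr.
have coord (x : 'rV[R]_d) i : `|x 0 i| <= `|x|.
  by rewrite [leRHS]mx_normrE; apply: (le_bigmax _ (fun k : 'I_1 * 'I_d => `|x k.1 k.2|) (0, i)).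
pose lo : 'rV[R]_d := const_mx (- m); pose hi : 'rV[R]_d := const_mx m.
have m0 : 0 <= m by rewrite /m; lra.
pose box := [set x : 'rV[R]_d | forall i, lo 0 i <= x 0 i <= hi 0 i].
have mbox : measurable box.
  rewrite -[X in measurable X]setCK; apply: measurableC; apply: open_measurable_rV.
  rewrite openC (_ : box = \bigcap_(i in [set: 'I_d])
    [set x : 'rV[R]_d | x 0 i \in `[lo 0 i, hi 0 i]]); last first.
    by apply/seteqP; split => x h i; [move=> _|]; have := h i; rewrite /= in_itv//=; apply.
  apply: closed_bigI => i _.
  apply: (@preimage_closed _ _ (fun x : 'rV[R]_d => x 0 i)
    [set t : R | t \in `[lo 0 i, hi 0 i]]).
    by move=> x _; exact: coord_continuous.
  exact: interval_closed.
have Abox : A `<=` box.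
  move=> x Ax i; rewrite !mxE -ler_norml; exact: (le_trans (coord x i) (bm x Ax)).
apply: (@le_lt_trans _ _ (lebesgue_rV d box)).
  by apply: le_measure => //; rewrite inE.
by rewrite lebesgue_rV_box ?ltry// => i; rewrite !mxE; lra.
Qed.

(** Nondecreasing functions are Borel, and linear growth preserves square
    integrability as constants are integrable on Om. *)
Lemma L2_comp {R : realType} {d : nat} (Om : set 'rV[R]_d) (b : R -> R) (M : R) u :
  measurable Om -> (lebesgue_rV d Om < +oo)%E -> {homo b : x y / x <= y} ->
  (forall x, `|b x| <= M * (1 + `|x|)) -> L2 Om u -> L2 Om (b \o u).
Proof.
move=> mOm foo bmono bM /(L2P mOm)[mu lu]; apply/(L2P mOm).
have mbu : measurable_fun Om (b \o u).
  by apply: measurableT_comp => //; exact: nondecreasing_measurable.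
split => //.
pose h x : R := 2 * M ^+ 2 * (1 + u x ^+ 2).
apply: (@le_integrable _ _ _ _ _ mOm _ (EFin \o h)).
- by apply/measurable_EFinP; exact: measurable_funX.
- move=> x _; rewrite /= lee_fin !ger0_norm ?sqr_ge0//; last first.
    by rewrite /h mulr_ge0 ?addr_ge0 ?sqr_ge0// mulr_ge0// sqr_ge0.
  rewrite /h -(real_normK (num_real (b (u x)))) -(real_normK (num_real (u x))).
  have := bM (u x); have := normr_ge0 (b (u x)); have := normr_ge0 (u x).
  move: `|u x| `|b (u x)| => U B U0 B0 BM.
  have : B ^+ 2 <= (M * (1 + U)) ^+ 2 by rewrite ler_sqr ?nnegrE// (le_trans B0).
  have : 0 <= M ^+ 2 * (1 - U) ^+ 2 by rewrite mulr_ge0 ?sqr_ge0.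
  by rewrite exprMn; nra.
- have c1 : (lebesgue_rV d).-integrable Om (EFin \o cst (1 : R)).
    apply/integrableP; split; first exact/measurable_EFinP.
    by rewrite /= integral_cst// lte_mul_pinfty// normr1.
  rewrite (_ : EFin \o h =
      fun x => ((2 * M ^+ 2)%R%:E * (1%R%:E + (u x ^+ 2)%R%:E))%E).
    by apply: integrableZl => //; exact: integrableD.
  by apply/funext => x; rewrite /= /h EFinM EFinD.
Qed.

Lemma powR_le1D {R : realType} (alpha x : R) : 0 < alpha -> alpha < 1 -> 0 <= x ->
  x `^ alpha <= 1 + x.
Proof.
move=> a0 a1 x0; have [x1|/ltW x1] := leP x 1.
  apply: (@le_trans _ _ 1); last by rewrite lerDl.
  have <- : 1 `^ alpha = 1 :> R by rewrite powR1.
  by rewrite ge0_ler_powR ?nnegrE// ltW.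
apply: (@le_trans _ _ x); last by rewrite lerDr.
by rewrite -[leRHS](powRr1 x0) ler_powR// ltW.
Qed.

(** * Absorbing the square of a Hoelder increment *)

(** The weighted Young inequality for the product of (c z)^s and m c^(-s) with
    conjugate exponents 1/s and 1/(1-s); c sets the slope in z. *)
Lemma powR_young_le {R : realType} (z s m c : R) :
  0 < s -> s < 1 -> 0 <= z -> 0 <= m -> 0 < c ->
  m * z `^ s <= s * c * z + (1 - s) * (m * c `^ (- s)) `^ (1 - s)^-1.
Proof.
move=> s0 s1 z0 m0 c0.
have s1' : 0 < 1 - s by rewrite subr_gt0.
have := @conjugate_powR R ((c * z) `^ s) (m * c `^ (- s)) s^-1 (1 - s)^-1.
rewrite !invr_gt0 !invrK powR_ge0 mulr_ge0 ?powR_ge0// => /(_ _ _ _ _ _)/wrap[]//.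
  by rewrite addrC subrK.
have cz0 : 0 <= c * z by rewrite mulr_ge0// ltW.
rewrite -powRrM mulfV ?gt_eqF// powRr1// powRM// ?(ltW c0)// powRN.
have cs0 : c `^ s != 0 by rewrite gt_eqF// powR_gt0.
rewrite (_ : _ * _ * _ = m * z `^ s); last by field.
by rewrite ![_ * (1 - s)]mulrC (_ : c * z * s = s * c * z) //; ring.
Qed.

Section HolderDissipation.
Context {R : realType}.
Variables (alpha Lb delta : R).
Hypotheses (alpha0 : 0 < alpha) (alpha1 : alpha < 1) (Lb0 : 0 < Lb) (delta0 : 0 < delta).

Let s := 2 * alpha / (1 + alpha).

(** Multiplying B <= Lb D^alpha by B^alpha bounds B^(1+alpha) by
    Lb (D B)^alpha; the claim is its power 2/(1+alpha), obtained by comparing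
    logarithms. *)
Lemma sqr_le_powR_holder (D B : R) : 0 <= D -> 0 <= B -> B <= Lb * D `^ alpha ->
  B ^+ 2 <= Lb `^ (2 / (1 + alpha)) * (D * B) `^ s.
Proof.
move=> D0; rewrite le_eqVlt => /predU1P[<- _|B0 BD].
  by rewrite expr0n/= mulr_ge0// powR_ge0.
have {}D0 : 0 < D.
  rewrite lt_neqAle D0 andbT; apply: contraTneq BD => <-.
  by rewrite powR0 ?gt_eqF// mulr0 -ltNge.
have a1 : 1 + alpha != 0 by rewrite gt_eqF// addr_gt0.
move: BD; rewrite -ler_ln ?posrE ?mulr_gt0 ?powR_gt0// lnM ?posrE ?powR_gt0// ln_powR => h.
rewrite -ler_ln ?posrE ?exprn_gt0 ?mulr_gt0 ?powR_gt0 ?mulr_gt0//.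
rewrite !lnM ?posrE ?powR_gt0 ?mulr_gt0// !ln_powR lnM ?posrE//.
rewrite -subr_ge0 (_ : _ - _ = 2 / (1 + alpha) * (ln Lb + alpha * ln D - ln B)).
  by rewrite mulr_ge0 ?subr_ge0// divr_ge0// ltW// addr_gt0.
by rewrite /s; field.
Qed.

(** The left-hand side is the remainder of [powR_young_le] when c = delta / s,
    that is, when the slope in D B equals delta; the right-hand side is the
    term that [Cholder] contributes per unit volume. *)
Lemma young_holder_constE :
  (1 - s) * (delta ^+ 2 * Lb `^ (2 / (1 + alpha)) * (delta / s) `^ (- s)) `^ (1 - s)^-1 =
  (1 - alpha) * (Lb * (2 * alpha) `^ alpha) `^ (2 / (1 - alpha))
  * (1 + alpha) `^ (- ((1 + alpha) / (1 - alpha))) * delta `^ (2 / (1 - alpha)).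
Proof.
have p0 : 0 < 1 + alpha by rewrite addr_gt0.
have m0 : 0 < 1 - alpha by rewrite subr_gt0.
have t0 : 0 < 2 * alpha by rewrite mulr_gt0.
have sE : 1 - s = (1 - alpha) / (1 + alpha) by rewrite /s; field; rewrite gt_eqF.
have dsE : delta / s = delta * (1 + alpha) / (2 * alpha).
  by rewrite /s; field; rewrite !gt_eqF.
rewrite sE dsE; apply: ln_inj; rewrite ?posrE ?(mulr_gt0, invr_gt0, powR_gt0)//.
rewrite !(lnM, lnV, ln_powR) ?posrE ?(mulr_gt0, invr_gt0, powR_gt0)//.
by rewrite /s; field; rewrite !gt_eqF.
Qed.

(** The slope delta is half of the coefficient 2 delta of D B that the expansion
    of the linearisation error offers; this choice gives exactly the constant
    of [Cholder]. *)
Lemma holder_dissipation (D B : R) : 0 <= D -> 0 <= B -> B <= Lb * D `^ alpha ->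
  delta ^+ 2 * B ^+ 2 <= delta * (D * B)
    + 2 * Cholder Lb 1 alpha * delta `^ (2 / (1 - alpha)).
Proof.
move=> D0 B0 BD.
have s0 : 0 < s by rewrite /s divr_gt0 ?mulr_gt0 ?addr_gt0.
have s1 : s < 1.
  by rewrite /s ltr_pdivrMr ?addr_gt0//; move: alpha1; lra.
have := @powR_young_le R (D * B) s (delta ^+ 2 * Lb `^ (2 / (1 + alpha))) (delta / s).
rewrite young_holder_constE => /(_ s0 s1 (mulr_ge0 D0 B0)) h.
have {}h := h (mulr_ge0 (sqr_ge0 _) (powR_ge0 _ _)) (divr_gt0 delta0 s0).
apply: le_trans (le_trans h _).
  by rewrite -mulrA ler_wpM2l ?sqr_ge0// sqr_le_powR_holder.
rewrite [s * _]mulrC divfK ?gt_eqF// lerD2l le_eqVlt; apply/orP; left; apply/eqP.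
by rewrite /Cholder; field.
Qed.

End HolderDissipation.

(** * The linearisation error *)

Section LinearisationError.
Context {R : realType} {d : nat}.
Variables (Om : set 'rV[R]_d).
Hypotheses (mOm : measurable Om) (foo : (lebesgue_rV d Om < +oo)%E).
Variables (alpha Lb : R) (b : R -> R).
Hypotheses (alpha0 : 0 < alpha) (alpha1 : alpha < 1) (Lb0 : 0 < Lb).
Hypotheses (bmono : {homo b : x y / x <= y}).
Hypothesis bholder : forall x y, `|b x - b y| <= Lb * `|x - y| `^ alpha.

Lemma L2_comp_holder u : b 0 = 0 -> L2 Om u -> L2 Om (b \o u).
Proof.
move=> b0; apply: (@L2_comp _ _ _ _ Lb) => // x.
have := bholder x 0; rewrite b0 !subr0 => /le_trans; apply.
by rewrite ler_pM2l// powR_le1D.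
Qed.

(** Monotonicity makes (x - y) (b x - b y) equal to the product of the absolute
    values, so that the cross term of the square dominates the bound of
    [holder_dissipation]. *)
Lemma linearisation_pointwise (delta x y : R) : 0 < delta ->
  ((x - y) - delta * (b x - b y)) ^+ 2 <=
  (x - y) ^+ 2 + 2 * Cholder Lb 1 alpha * delta `^ (2 / (1 - alpha)).
Proof.
move=> delta0.
have DB : (x - y) * (b x - b y) = `|x - y| * `|b x - b y|.
  rewrite -normrM ger0_norm//; have [xy|/ltW xy] := leP x y.
    by rewrite mulr_le0// subr_le0// bmono.
  by rewrite mulr_ge0// subr_ge0// bmono.
have := holder_dissipation alpha0 alpha1 Lb0 delta0 (normr_ge0 _) (normr_ge0 _)
  (bholder x y).
have : 0 <= delta * (`|x - y| * `|b x - b y|) by rewrite !mulr_ge0// ltW.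
rewrite -DB real_normK ?num_real//.
set K := 2 * _ * _; move: (x - y) (b x - b y) K => D B K; nra.
Qed.

Lemma linearisation_error (delta : R) u v : 0 < delta -> b 0 = 0 ->
  L2 Om u -> L2 Om v ->
  norm2 Om ((u \- v) \- (fun x => delta * (((b \o u) \- (b \o v)) x))) ^+ 2
  <= norm2 Om (u \- v) ^+ 2 + 2 * Cholder Lb (volume Om) alpha * delta `^ (2 / (1 - alpha)).
Proof.
move=> delta0 b0 lu lv; rewrite !norm2_sqr; set g := (X in ip Om X _).
have luv := L2B lu lv.
have lg : L2 Om g.
  by apply: L2B => //; apply: L2Z => //; apply: L2B => //; exact: L2_comp_holder.
pose K := 2 * Cholder Lb 1 alpha * delta `^ (2 / (1 - alpha)).
have iK : (lebesgue_rV d).-integrable Om (EFin \o cst K).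
  apply/integrableP; split; first exact/measurable_EFinP.
  by rewrite /= integral_cst// lte_mul_pinfty.
have -> : 2 * Cholder Lb (volume Om) alpha * delta `^ (2 / (1 - alpha)) =
    \int[lebesgue_rV d]_(x in Om) K.
  by rewrite Rintegral_cst// /K /Cholder /volume; ring.
rewrite -RintegralD//; last exact: L2_integrableM.
apply: le_Rintegral => //; first exact: L2_integrableM.
  rewrite (_ : _ \o _ = (fun x => (((u \- v) x * (u \- v) x)%:E + K%:E)%E)).
    by apply: integrableD => //; exact: L2_integrableM.
  by apply/funext => x; rewrite /= EFinD.
by move=> x _; rewrite -!expr2; exact: linearisation_pointwise.
Qed.

End LinearisationError.

(** * Discrete fluxes *)

Section MixedPairs.
Context {R : realType} {d : nat}.
Variables (Om : set 'rV[R]_d) (mOm : measurable Om) (Th : set (set 'rV[R]_d)).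
Implicit Types (u w dq : 'rV[R]_d -> R) (q v : 'rV[R]_d -> 'rV[R]_d).

Lemma WhB u w : Wh Om Th u -> Wh Om Th w -> Wh Om Th (u \- w).
Proof.
move=> [lu cu] [lw cw]; split; first exact: L2B.
move=> T TT; have [c hc] := cu T TT; have [c' hc'] := cw T TT.
exists (c - c'); apply: filterS2 hc hc' => x h h' Tx.
by rewrite /= h// h'.
Qed.

Lemma Vh_L2v q : Vh Om Th q -> L2v Om q.
Proof. by move=> [[g []]]. Qed.

(** q is the mixed discrete counterpart of the gradient of u, with the
    homogeneous Dirichlet condition imposed weakly. *)
Definition discrete_flux u q : Prop :=
  forall v dv, Vh Om Th v -> weak_div Om v dv -> ipv Om q v = ip Om u dv.

Lemma discrete_fluxB u1 q1 u2 q2 : L2 Om u1 -> L2 Om u2 -> L2v Om q1 -> L2v Om q2 ->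
  discrete_flux u1 q1 -> discrete_flux u2 q2 ->
  discrete_flux (u1 \- u2) (q1 \- q2).
Proof.
move=> lu1 lu2 lq1 lq2 f1 f2 v dv hv wv.
have ldv : L2 Om dv by case: wv.
by rewrite ipvBl// ?ipBl// ?(f1 v dv)// ?(f2 v dv)//; exact: Vh_L2v hv.
Qed.

(** Discrete integration by parts: the relation for the difference is tested
    with q1 and with q2 separately, so that the divergence of q1 - q2 itself
    never has to be formed. *)
Lemma discrete_flux_energy u1 q1 dq1 u2 q2 dq2 :
  L2 Om u1 -> L2 Om u2 -> Vh Om Th q1 -> Vh Om Th q2 ->
  weak_div Om q1 dq1 -> weak_div Om q2 dq2 ->
  discrete_flux u1 q1 -> discrete_flux u2 q2 ->
  ip Om (dq1 \- dq2) (u1 \- u2) = ipv Om (q1 \- q2) (q1 \- q2).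
Proof.
move=> lu1 lu2 vq1 vq2 w1 w2 f1 f2.
have [lq1 lq2] := (Vh_L2v vq1, Vh_L2v vq2).
have [ld1 ld2] : L2 Om dq1 /\ L2 Om dq2 by case: w1; case: w2.
have f := discrete_fluxB lu1 lu2 lq1 lq2 f1 f2.
rewrite ipvBr//; last exact: L2vB.
by rewrite (f q1 dq1)// (f q2 dq2)// ipC ipBr//; exact: L2B.
Qed.

(** Testing the flux relation with a field v of divergence u gives
    |u|^2 = <q, v>; Young's inequality with weight C^2 then leaves half of
    |u|^2 on the right, which is absorbed. *)
Lemma discrete_poincare C u q : 0 < C -> div_stable Om Th C ->
  Wh Om Th u -> L2v Om q -> discrete_flux u q ->
  ip Om u u <= C ^+ 2 * ipv Om q q.
Proof.
move=> C0 stab wu lq f; have [v [hv wv vu]] := stab u wu.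
have lv := Vh_L2v hv.
have C20 : 0 < C ^+ 2 by rewrite exprn_gt0.
have := ipv_young mOm C20 lq lv; rewrite (f v u)//.
have : C ^- 2 * ipv Om v v <= ip Om u u.
  rewrite mulrC ler_pdivrMr// mulrC -norm2v_sqr -norm2_sqr -exprMn.
  by rewrite ler_sqr// ?nnegrE ?mulr_ge0 ?sqrtr_ge0// ltW.
lra.
Qed.

End MixedPairs.

(** * The contraction estimate *)

Theorem theorem1 (R : realType) (d : nat) (hd : (1 <= d <= 3)%N)
  (Om : set 'rV[R]_d) (hOm : bounded_lipschitz_domain Om)
  (COm : R) (hCOm : 0 < COm)
  (h : R) (Th : set (set 'rV[R]_d)) (hTh : regular_decomposition Om Th h)
  (hstab : div_stable Om Th COm)
  (alpha Lb : R) (halpha0 : 0 < alpha) (halpha1 : alpha < 1) (hLb : 0 < Lb)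
  (b : R -> R) (hbmono : {homo b : x y / x <= y}) (hb0 : b 0 = 0)
  (hbholder : forall x y, `|b x - b y| <= Lb * `|x - y| `^ alpha)
  (delta L tau : R) (hdelta : 0 < delta) (hL : L = 1 / delta) (htau : 0 < tau)
  (f : 'rV[R]_d -> R) (hf : L2 Om f)
  (n : nat) (hn : (1 <= n)%N)
  (uh : nat -> 'rV[R]_d -> R) (qh : nat -> 'rV[R]_d -> 'rV[R]_d)
  (huprev : Wh Om Th (uh n.-1))
  (hunique : uniquely_solvable_P Om Th b tau f (uh n.-1))
  (hsol : solves_P Om Th b tau f (uh n.-1) (uh n) (qh n))
  (i : nat) (hi : (1 <= i)%N)
  (uhn : nat -> 'rV[R]_d -> R) (qhn : nat -> 'rV[R]_d -> 'rV[R]_d)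
  (huold : Wh Om Th (uhn i.-1))
  (hlin : solves_P_lin Om Th b L tau f (uh n.-1) (uhn i.-1) (uhn i) (qhn i)) :
  norm2 Om (uhn i \- uh n) ^+ 2
    + tau * delta * Rfactor COm delta tau * norm2v Om (qhn i \- qh n) ^+ 2
  <= Rfactor COm delta tau * norm2 Om (uhn i.-1 \- uh n) ^+ 2
    + 2 * Cholder Lb (volume Om) alpha * Rfactor COm delta tau
      * delta `^ (2 / (1 - alpha)).
Proof.
have [_ oOm _ bOm _] := hOm.
have mOm : measurable Om := open_measurable_rV oOm.
have foo := bounded_lebesgue_rV_fin mOm bOm.
move: hsol hlin; set u := uh n; set up := uh n.-1; set q := qh n.
set u1 := uhn i; set u0 := uhn i.-1; set q1 := qhn i.
move=> [wu vq Pu Pq] [wu1 vq1 Pu1 Pq1].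
have [lup lu lu0 lu1] : [/\ L2 Om up, L2 Om u, L2 Om u0 & L2 Om u1].
  by split; [case: huprev|case: wu|case: huold|case: wu1].
have lb v : L2 Om v -> L2 Om (b \o v).
  exact: (L2_comp_holder mOm foo halpha0 halpha1 hLb hbmono hbholder hb0).
have [lq lq1] := (Vh_L2v vq, Vh_L2v vq1).
have flux : discrete_flux Om Th u q.
  by move=> v dv hv wv; apply/eqP; rewrite -subr_eq0; apply/eqP; exact: Pq.
have flux1 : discrete_flux Om Th u1 q1.
  by move=> v dv hv wv; apply/eqP; rewrite -subr_eq0; apply/eqP; exact: Pq1.
have [[dq wdq] [dq1 wdq1]] : Hdiv Om q /\ Hdiv Om q1 by case: vq; case: vq1.
have [ldq ldq1] : L2 Om dq /\ L2 Om dq1 by case: wdq; case: wdq1.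
set e := u1 \- u; set eq := q1 \- q.
have we : Wh Om Th e by exact: WhB.
have le : L2 Om e by case: we.
have energy : ip Om dq1 e - ip Om dq e = ipv Om eq eq.
  by rewrite -ipBl//; exact: discrete_flux_energy flux1 flux.
have poincare : ip Om e e <= COm ^+ 2 * ipv Om eq eq.
  apply: (discrete_poincare mOm hCOm hstab we); first exact: L2vB.
  exact: discrete_fluxB.
pose g := (u0 \- u) \- (fun x => delta * (((b \o u0) \- (b \o u)) x)).
have lg : L2 Om g.
  by do !(apply: L2B || apply: L2Z) => //; exact: lb.
have lin : ip Om g g <= ip Om (u0 \- u) (u0 \- u)
    + 2 * Cholder Lb (volume Om) alpha * delta `^ (2 / (1 - alpha)).
  by rewrite -!norm2_sqr; exact: linearisation_error.
(* Both scalar equations tested with e, the integrals split into single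
   products; test1 - test times delta is the error equation. *)
have test1 : L * (ip Om u1 e - ip Om u0 e) + ip Om (b \o u0) e
    + tau * ip Om dq1 e = ip Om (b \o up) e + ip Om f e.
  rewrite -(Pu1 e dq1)//; congr (_ + _).
  rewrite -ipBl// -ipZl// -?ipDl//; try exact: lb.
    by apply: L2Z => //; exact: L2B.
  exact: L2B.
have test : ip Om (b \o u) e - ip Om (b \o up) e + tau * ip Om dq e = ip Om f e.
  by rewrite -(Pu e dq)// ipBl//; exact: lb.
have ge : ip Om g e =
    ip Om u0 e - ip Om u e - delta * (ip Om (b \o u0) e - ip Om (b \o u) e).
  rewrite ipBl// ?ipZl// ?ipBl//; try exact: lb.
  - by apply: L2B; exact: lb.
  - exact: L2B.
  - by apply: L2Z => //; apply: L2B; exact: lb.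
have ee : ip Om e e = ip Om u1 e - ip Om u e by rewrite ipBl.
have young := ip_young mOm ltr01 lg le.
rewrite invr1 !mul1r in young.
rewrite !norm2_sqr norm2v_sqr.
have step : ip Om e e + tau * delta * ipv Om eq eq = ip Om g e.
  rewrite ge ee -energy; apply: subr0_eq.
  move: test1 test; rewrite hL.
  set a1 := ip Om u1 e; set a0 := ip Om u0 e; set b0 := ip Om (b \o u0) e.
  set bu := ip Om (b \o u) e; set bp := ip Om (b \o up) e.
  move=> test1 test.
  have -> : a1 - ip Om u e + tau * delta * (ip Om dq1 e - ip Om dq e)
      - (a0 - ip Om u e - delta * (b0 - bu)) =
    delta * ((1 / delta * (a1 - a0) + b0 + tau * ip Om dq1 e)
      - (bp + (bu - bp + tau * ip Om dq e))) by field; rewrite gt_eqF.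
  by rewrite test1 test subrr mulr0.
have main : (1 + tau * delta / COm ^+ 2) * ip Om e e + tau * delta * ipv Om eq eq
    <= ip Om (u0 \- u) (u0 \- u)
      + 2 * Cholder Lb (volume Om) alpha * delta `^ (2 / (1 - alpha)).
  have : tau * delta / COm ^+ 2 * ip Om e e <= tau * delta * ipv Om eq eq.
    rewrite -mulrA ler_pM2l ?mulr_gt0// mulrC ler_pdivrMr ?exprn_gt0//.
    by rewrite mulrC.
  by move: lin young step; lra.
have rho : 0 < 1 + tau * delta / COm ^+ 2.
  by rewrite addr_gt0// divr_gt0 ?mulr_gt0 ?exprn_gt0.
rewrite /Rfactor -(ler_pM2l rho); move: main rho.
move: (1 + _) => r main r0; apply: le_trans (le_trans main _).
  by rewrite le_eqVlt; apply/orP; left; apply/eqP; field; rewrite gt_eqF.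
by rewrite le_eqVlt; apply/orP; left; apply/eqP; field; rewrite gt_eqF.
Qed.
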